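(* Let $X$ be a completely regular topological space whose topology is generated by a family of pseudometrics $\Pi$. Then the weak topology on the set $\mathcal{M}^+_r(X)$ of nonnegative Radon measures is generated by the family of seminorms $\|\cdot\|_{KR,p}$, $p\in\Pi$. In addition, the weak topology is generated by these seminorms on every set in $\mathcal{M}_r(X)$ that is bounded in variation and uniformly tight.
   Context: A pseudometric differs from a metric in that it can be zero on distinct elements; the topology of a completely regular space is generated by a family of pseudometrics. A finite nonnegative Borel measure $\mu$ is Radon if for every Borel set $B$ and every $\varepsilon>0$ there is a compact set $K\subset B$ with $\mu(B\setminus K)<\varepsilon$; a signed Borel measure is Radon if its total variation $|\mu|$ is. $\mathcal{M}_r(X)$ is the linear space of all (signed) Radon measures on $X$, and $\mathcal{M}_r^+(X)$ is its subset of nonnegative measures. The weak topology on $\mathcal{M}_r(X)$ is generated by the seminorms $\mu\mapsto|\int_X f\,d\mu|$, $f\in C_b(X)$ (bounded continuous functions). A set $M\subset\mathcal{M}_r(X)$ is uniformly tight if for every $\varepsilon>0$ there is a compact set $K$ with $|\mu|(X\setminus K)<\varepsilon$ for all $\mu\in M$; it is bounded in variation if $\sup_{\mu\in M}|\mu|(X)<\infty$. For a pseudometric $p$, ${\rm Lip}_1(p)$ is the class of functions $f\colon X\to\mathbb{R}$ with $|f(x)-f(y)|\le p(x,y)$ for all $x,y$, and $$\|\mu\|_{KR,p}=\sup\Bigl\{\int_X f\,d\mu\colon f\in{\rm Lip}_1(p),\ |f|\le 1\Bigr\}.$$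
   Formalization: The family Π is additionally assumed nonempty and uniformly directed (for p, q in Π and e>0 some r in Π and d>0 have r<d imply p<e and q<e); without this the claim fails, e.g. for the two coordinate pseudometrics on the plane. *)

(* Defs.v *)
From HB Require Import structures.
From mathcomp Require Import all_boot all_order all_algebra.
From mathcomp Require Import all_classical all_reals all_analysis.
Import Order.TTheory GRing.Theory Num.Theory.
Import numFieldNormedType.Exports.

Set Implicit Arguments.
Unset Strict Implicit.
Unset Printing Implicit Defensive.

Local Open Scope classical_set_scope.
Local Open Scope ring_scope.

Section Pseudometrics.
Context {R : realType} {X : topologicalType}.
Implicit Types (p q r : X -> X -> R) (Pi : set (X -> X -> R)).

Definition is_pseudometric p : Prop :=
  [/\ forall x, p x x = 0,
      forall x y, 0 <= p x y,
      forall x y, p x y = p y x &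
      forall x y z, p x z <= p x y + p y z].

(* The p-balls, p in Pi, form a subbase: basic neighbourhoods of x are finite
   intersections of balls centred at x. *)
Definition topology_generated_by Pi : Prop :=
  forall (x : X) (A : set X),
    nbhs x A <->
    exists (n : nat) (p : 'I_n -> X -> X -> R) (e : R),
      [/\ forall i, Pi (p i), 0 < e &
          [set y | forall i, p i x y < e] `<=` A].

(* The entourages {(x, y) | p x y < e}, p in Pi, form a filter base. This is
   implied by closure of Pi under pairwise maxima (plus Pi nonempty), which is
   part of the usual notion of a family of pseudometrics defining a uniformity
   (e.g. in Engelking's "General Topology"). It cannot be dropped: the two
   coordinate pseudometrics generate the topology of the plane, but their
   Kantorovich-Rubinshtein seminorms see only the marginals of a measure. *)
Definition directed_family Pi : Prop :=
  Pi !=set0 /\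
  forall p q, Pi p -> Pi q -> forall e : R, 0 < e ->
    exists (r : X -> X -> R) (d : R),
      [/\ Pi r, 0 < d &
          forall x y, r x y < d -> p x y < e /\ q x y < e].

Definition lip1 p : set (X -> R) :=
  [set f | forall x y, `|f x - f y| <= p x y].

Definition bounded_continuous : set (X -> R) :=
  [set f | continuous f /\ bounded_fun f].

End Pseudometrics.

(* Measurable types are pointed in the library, hence the pointed X. *)
Definition borelType (X : ptopologicalType) := g_sigma_algebraType (@open X).

(* Charges are finite-valued on measurable sets. Two charges that differ only
   on non-Borel sets are not identified, but nothing below sees the
   difference. *)
Definition signed_measure (X : ptopologicalType) (R : realType) : Type :=
  {charge set (borelType X) -> \bar R}.

Section SignedMeasures.
Context {X : ptopologicalType} {R : realType}.
Implicit Types nu mu : signed_measure X R.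

Definition csub nu mu : signed_measure X R := cadd nu (copp mu).

Definition hahn_pos nu : set (borelType X) := sval (cid (Hahn_decomposition nu)).

Definition hahn_neg nu : set (borelType X) :=
  sval (cid (svalP (cid (Hahn_decomposition nu)))).

Lemma hahn_pos_neg nu : hahn_decomposition nu (hahn_pos nu) (hahn_neg nu).
Proof. exact: svalP (cid (svalP (cid (Hahn_decomposition nu)))). Qed.

Definition total_variation nu : set (borelType X) -> \bar R :=
  charge_variation (hahn_pos_neg nu).

Definition cintegral nu (f : X -> R) : R :=
  \int[jordan_pos (hahn_pos_neg nu)]_x f x -
  \int[jordan_neg (hahn_pos_neg nu)]_x f x.

(* Measurability of K is automatic when X is Hausdorff; without it
   mu (B `\` K) would not be meaningful. *)
Definition radon_measure (mu : set (borelType X) -> \bar R) : Prop :=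
  forall B : set (borelType X), measurable B -> forall e : R, 0 < e ->
    exists K : set X, [/\ compact K, measurable (K : set (borelType X)),
      K `<=` B & (mu (B `\` K) < e%:E)%E].

Definition radon : set (signed_measure X R) :=
  [set nu | radon_measure (total_variation nu)].

Definition nonneg_radon : set (signed_measure X R) :=
  [set nu | radon nu /\
    forall B : set (borelType X), measurable B -> (0 <= nu B)%E].

Definition uniformly_tight (M : set (signed_measure X R)) : Prop :=
  forall e : R, 0 < e -> exists K : set X,
    [/\ compact K, measurable (K : set (borelType X)) &
        forall nu, M nu -> (total_variation nu (~` K) < e%:E)%E].

Definition bounded_in_variation (M : set (signed_measure X R)) : Prop :=
  exists C : R, forall nu, M nu -> (total_variation nu setT <= C%:E)%E.

Definition KR_seminorm (p : X -> X -> R) nu : R :=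
  sup [set cintegral nu f |
        f in [set f | lip1 p f /\ forall x, `|f x| <= 1]].

Definition KR_seminorms (Pi : set (X -> X -> R)) :
    set (signed_measure X R -> R) :=
  [set KR_seminorm p | p in Pi].

Definition weak_seminorms : set (signed_measure X R -> R) :=
  [set (fun nu => `|cintegral nu f|) | f in bounded_continuous].

Definition semiballs (Q : set (signed_measure X R -> R)) :
    set (set (signed_measure X R)) :=
  [set B | exists (q : signed_measure X R -> R) (mu : signed_measure X R)
             (e : R),
     [/\ Q q, 0 < e & B = [set nu | q (csub nu mu) < e]]].

(* All signed measures, with the topology generated by the seminorms in Q. *)
Definition seminorm_space (Q : set (signed_measure X R -> R)) : Type :=
  signed_measure X R.

Section SeminormTopology.
Variable Q : set (signed_measure X R -> R).

HB.instance Definition _ := gen_eqMixin (seminorm_space Q).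
HB.instance Definition _ := gen_choiceMixin (seminorm_space Q).
HB.instance Definition _ :=
  isSubBaseTopological.Build (seminorm_space Q) (semiballs Q) id.

End SeminormTopology.

(* Q1 and Q2 induce the same topology on M. In the library's [subspace M] the
   points outside M are isolated, so an open set there is exactly a set whose
   trace on M is relatively open. *)
Definition same_topology_on (Q1 Q2 : set (signed_measure X R -> R))
    (M : set (signed_measure X R)) : Prop :=
  forall U : set (signed_measure X R),
    open (U : set (subspace (M : set (seminorm_space Q1)))) <->
    open (U : set (subspace (M : set (seminorm_space Q2)))).

End SignedMeasures.

(* Main.v *)
(* A signed measure is split into a part seen on a compact set K and a small
   tail.  The same local tightness property covers both claims: near a given
   nu0, the total masses are bounded, and a continuous u with 0 <= u <= 1
   vanishing on K has small |nu|-integral once the integrals of 1 and u against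
   nu and nu0 are close.  For nonnegative measures this is because |nu| = nu.

   Weak topology finer: a finite partition of unity psi_i subordinate to p-balls
   of radius eps around points x_i of K, with remainder u vanishing on K, gives
   |f - sum_i f(x_i) psi_i| <= eps + u for all f in Lip_1(p) with |f| <= 1 at
   once, so finitely many weak conditions control the whole supremum.

   Kantorovich-Rubinshtein topology finer: for f bounded continuous, compactness
   of K and directedness of Pi give a single p in Pi for which f is uniformly
   continuous near K.  The inf-convolution g(x) = inf_y (f(y) + L p(x,y)) is then
   p-Lipschitz, and |f - g| <= eps + 2B u where u, the inf-convolution of the
   indicator of the complement of K, is also p-Lipschitz. *)
Require Import Defs.
From mathcomp Require Import all_boot all_order all_algebra.
From mathcomp Require Import all_classical all_reals all_analysis.
From mathcomp Require Import finmap ring lra measurable_realfun.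
Import Order.TTheory GRing.Theory Num.Theory.
Import numFieldNormedType.Exports.
Set Implicit Arguments.
Unset Strict Implicit.
Unset Printing Implicit Defensive.
Local Open Scope classical_set_scope.
Local Open Scope ring_scope.

(** * Topologies generated by seminorms and their traces on a set *)

Section Topology.
Context {R : realType} {X : ptopologicalType}.
Implicit Types (Q : set (signed_measure X R -> R)) (M : set (signed_measure X R)).

Lemma open_seminorm_spaceP Q (V : set (seminorm_space Q)) :
  open V <-> exists2 D', D' `<=` finI_from (semiballs Q) id &
                         \bigcup_(A in D') A = V.
Proof. by []. Qed.

Lemma near_semiball Q q (nu0 : signed_measure X R) (e : R) :
  Q q -> q (csub nu0 nu0) = 0 -> 0 < e ->
  \forall nu \near (nu0 : seminorm_space Q), q (csub nu nu0) < e.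
Proof.
move=> Qq q0 e0; apply: (@open_nbhs_nbhs (seminorm_space Q)).
split; last by rewrite /= q0.
apply/open_seminorm_spaceP.
exists [set [set nu | q (csub nu nu0) < e]]; last exact: bigcup_set1.
by move=> _ ->; apply: (@finI_from1 _ _ (semiballs Q) id); exists q, nu0, e.
Qed.

(** By the triangle inequality a semiball with any centre [mu] that contains [nu0] contains the
    semiball around [nu0] of radius [e - q (csub nu0 mu)]. Hence smallness of each [q] at the points
    of [M], along [M], suffices; finite intersections are handled by the neighbourhood filter. *)
Lemma open_subspace_transfer Q1 Q2 M :
  (forall q nu nu0 mu, Q1 q ->
    q (csub nu mu) <= q (csub nu nu0) + q (csub nu0 mu)) ->
  (forall q nu0 (e : R), Q1 q -> M nu0 -> 0 < e ->
    \forall nu \near (nu0 : seminorm_space Q2), M nu -> q (csub nu nu0) < e) ->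
  forall U : set (signed_measure X R),
  open (U : set (subspace (M : set (seminorm_space Q1)))) ->
  open (U : set (subspace (M : set (seminorm_space Q2)))).
Proof.
move=> triQ1 nearQ U /open_subspaceP[V oV VU]; apply/open_subspaceP.
have [D' D'Q D'V] := (open_seminorm_spaceP V).1 oV.
rewrite -{}D'V {V oV} in VU.
(* The implication leaves points outside [M] unconstrained, so this is the largest open set whose
   trace on [M] lies in [U]. *)
exists (interior ([set nu | M nu -> U nu] : set (seminorm_space Q2))).
  exact: open_interior.
apply/seteqP; split=> nu0 [+ Mnu0]; first by move/interior_subset => /(_ Mnu0).
move=> Unu0; split=> //.
have [[A D'A Anu0] _] : ((\bigcup_(A in D') A) `&` M) nu0 by rewrite VU.
rewrite /interior /=.
have [F FQ FA] := D'Q _ D'A.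
suff : \forall nu \near (nu0 : seminorm_space Q2), M nu -> A nu.
  apply: filterS => nu MA Mnu.
  suff [] : (U `&` M) nu by [].
  by rewrite -VU; split=> //; exists A => //; exact: MA.
have nF : nbhs (nu0 : seminorm_space Q2)
    (\bigcap_(B in [set` F]) [set nu | M nu -> B nu]).
  apply: filter_bigI => B FB.
  have : B nu0 by move: Anu0; rewrite -FA; exact.
  have /set_mem[q [mu [e [Qq e0 ->]]]] := FQ _ FB.
  move=> /= Bnu0.
  have d0 : 0 < e - q (csub nu0 mu) by rewrite subr_gt0.
  apply: filterS (nearQ _ _ _ Qq Mnu0 d0) => nu /[apply] qd.
  by rewrite (le_lt_trans (triQ1 q nu nu0 mu Qq))// -ltrBrDr.
by apply: filterS nF => nu nF Mnu; rewrite -FA => B FB; exact: nF.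
Qed.

End Topology.

(** * Bounded measurable functions and their integrals against finite measures *)

Lemma bounded_funP (T : Type) (R : realType) (f : T -> R) :
  bounded_fun f <-> exists C, forall x, `|f x| <= C.
Proof.
split=> [[M [_ fM]]|[C fC]].
  (* [bounded_fun] provides only the bounds strictly above [M]. *)
  by exists (M + 1) => x; apply: fM => //; rewrite ltrDl.
by exists C; split; [exact: num_real|move=> M /ltW CM x _; exact: le_trans CM].
Qed.

Section BoundedMeasurable.
Context {d : measure_display} {T : measurableType d} {R : realType}.
Implicit Types (f g : T -> R) (mu : {finite_measure set T -> \bar R}).

Definition bounded_measurable f :=
  measurable_fun [set: T] f /\ exists C, forall x, `|f x| <= C.

Lemma bounded_measurable_integrable mu f :
  bounded_measurable f -> mu.-integrable [set: T] (EFin \o f).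
Proof.
move=> [mf [C fC]]; apply: measurable_bounded_integrable => //.
  by rewrite -ge0_fin_numE// fin_num_measure.
by apply/bounded_funP; exists C.
Qed.

Lemma bounded_measurable_cst (c : R) : bounded_measurable (fun=> c).
Proof. by split; [exact: measurable_cst|exists `|c|]. Qed.

Lemma bounded_measurableD f g : bounded_measurable f ->
  bounded_measurable g -> bounded_measurable (fun x => f x + g x).
Proof.
move=> [mf [C fC]] [mg [D gD]]; split; first exact: measurable_funD.
by exists (C + D) => x; rewrite (le_trans (ler_normD _ _))// lerD.
Qed.

Lemma bounded_measurableZ (a : R) f : bounded_measurable f ->
  bounded_measurable (fun x => a * f x).
Proof.
move=> [mf [C fC]]; split; first exact: measurable_funM.
by exists (`|a| * C) => x; rewrite normrM ler_wpM2l.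
Qed.

Lemma bounded_measurableB f g : bounded_measurable f ->
  bounded_measurable g -> bounded_measurable (fun x => f x - g x).
Proof.
move=> bf bg; rewrite (_ : (fun x => _) = (fun x => f x + -1 * g x)).
  exact/bounded_measurableD/bounded_measurableZ.
by apply/funext => x; rewrite mulN1r.
Qed.

Lemma bounded_measurable_norm f : bounded_measurable f ->
  bounded_measurable (fun x => `|f x|).
Proof.
move=> [mf [C fC]]; split; first exact: measurableT_comp.
by exists C => x; rewrite normr_id.
Qed.

Lemma integral_add3 (m1 m2 m3 : {finite_measure set T -> \bar R}) f :
  bounded_measurable f ->
  (\int[measure_add m1 (measure_add m2 m3)]_x (f x)%:E =
   (\int[m1]_x f x + \int[m2]_x f x + \int[m3]_x f x)%R%:E)%E.
Proof.
move=> bf; have int m := bounded_measurable_integrable m bf.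
have mf : measurable_fun [set: T] (fun x => (f x)%:E).
  by apply/measurable_EFinP; case: bf.
have int23 : (measure_add m2 m3).-integrable [set: T] (EFin \o f).
  case: bf => {}mf [C fC]; apply: measurable_bounded_integrable => //.
    suff : (m2 setT + m3 setT < +oo)%E by rewrite -(measure_addE m2 m3).
    by rewrite lte_add_pinfty// -ge0_fin_numE// fin_num_measure.
  by apply/bounded_funP; exists C.
rewrite !integral_measure_add//; try exact: int.
by rewrite !EFinD -addeA !fineK//; apply: integrable_fin_num => //; exact: int.
Qed.

(** An identity between signed measures, with negative parts moved across, becomes one between sums
    of nonnegative measures, which can be integrated. *)
Lemma Rintegral_add3 (m1 m2 m3 n1 n2 n3 : {finite_measure set T -> \bar R}) f :
  (forall A, measurable A -> m1 A + (m2 A + m3 A) = n1 A + (n2 A + n3 A))%E ->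
  bounded_measurable f ->
  \int[m1]_x f x + \int[m2]_x f x + \int[m3]_x f x =
  \int[n1]_x f x + \int[n2]_x f x + \int[n3]_x f x.
Proof.
move=> mn bf; apply: EFin_inj; rewrite -!integral_add3//.
apply: eq_measure_integral => A mA _.
have E (k1 k2 k3 : {finite_measure set T -> \bar R}) :
    measure_add k1 (measure_add k2 k3) A = (k1 A + (k2 A + k3 A))%E.
  exact: etrans (measure_addE k1 _ A) (congr1 _ (measure_addE k2 k3 A)).
exact: etrans (E _ _ _) (etrans (mn _ mA) (esym (E _ _ _))).
Qed.

End BoundedMeasurable.

(** * Integration against a signed measure and against its total variation *)

Section SignedIntegral.
Context {R : realType} {X : ptopologicalType}.
Local Notation bm f := (bounded_measurable (f : borelType X -> R)).
Implicit Types (nu mu : signed_measure X R) (f g : X -> R).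

Local Notation pos nu := (jordan_pos (hahn_pos_neg nu)).
Local Notation neg nu := (jordan_neg (hahn_pos_neg nu)).

Lemma total_variation_fin nu : fin_num_fun (charge_variation (hahn_pos_neg nu)).
Proof. by move=> A mA; rewrite fin_num_measure. Qed.

Definition tvintegral nu (f : X -> R) : R := \int[pos nu]_x f x + \int[neg nu]_x f x.

Lemma cintegralD nu f g : bm f -> bm g ->
  cintegral nu (fun x => f x + g x) = cintegral nu f + cintegral nu g.
Proof.
move=> bf bg; rewrite /cintegral !RintegralD//;
  try exact: bounded_measurable_integrable.
by ring.
Qed.

Lemma cintegralZ nu (a : R) f : bm f ->
  cintegral nu (fun x => a * f x) = a * cintegral nu f.
Proof.
move=> bf; rewrite /cintegral !RintegralZl//;
  try exact: bounded_measurable_integrable.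
by rewrite -mulrBr.
Qed.

Lemma cintegral_sum (I : Type) (s : seq I) nu (F : I -> X -> R) :
  (forall i, bm (F i)) -> bm (fun x => \sum_(i <- s) F i x) /\
  cintegral nu (fun x => \sum_(i <- s) F i x) = \sum_(i <- s) cintegral nu (F i).
Proof.
move=> bF; elim: s => [|i s [bs IH]].
  under eq_fun do rewrite big_nil; split; first exact: bounded_measurable_cst.
  by rewrite big_nil /cintegral !Rintegral_cst// !mul0r subrr.
under eq_fun do rewrite big_cons; split; first exact: bounded_measurableD.
by rewrite cintegralD// IH big_cons.
Qed.

Lemma tvintegralD nu f g : bm f -> bm g ->
  tvintegral nu (fun x => f x + g x) = tvintegral nu f + tvintegral nu g.
Proof.
move=> bf bg; rewrite /tvintegral !RintegralD//;
  try exact: bounded_measurable_integrable.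
by ring.
Qed.

Lemma tvintegralZ nu (a : R) f : bm f ->
  tvintegral nu (fun x => a * f x) = a * tvintegral nu f.
Proof.
move=> bf; rewrite /tvintegral !RintegralZl//;
  try exact: bounded_measurable_integrable.
by rewrite -mulrDr.
Qed.

Lemma le_tvintegral nu f g : bm f -> bm g -> (forall x, f x <= g x) ->
  tvintegral nu f <= tvintegral nu g.
Proof.
by move=> bf bg fg; apply: lerD; apply: le_Rintegral => //;
  exact: bounded_measurable_integrable.
Qed.

Lemma normr_cintegral nu f g : bm f -> bm g -> (forall x, `|f x| <= g x) ->
  `|cintegral nu f| <= tvintegral nu g.
Proof.
move=> bf bg fg; apply: (le_trans (ler_normB _ _)).
apply: le_trans (le_tvintegral nu (bounded_measurable_norm bf) bg fg).
by apply: lerD; apply: le_normr_Rintegral => //;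
  exact: bounded_measurable_integrable.
Qed.

Lemma tvintegral_indic nu (A : set (borelType X)) : measurable A ->
  tvintegral nu (\1_A) = fine (Defs.total_variation nu A).
Proof.
move=> mA; rewrite /tvintegral /Rintegral !integral_indic// !setIT.
by rewrite -fineD// fin_num_measure.
Qed.

(** The Jordan parts of [nu - mu] need not be sums of Jordan parts of [nu] and [mu]. Writing [la]
    for the difference, only the balance [la+ + nu- + mu+ = la- + nu+ + mu-] holds, and integrating
    it is enough. *)
Lemma cintegral_csub nu mu f : bm f ->
  cintegral (csub nu mu) f = cintegral nu f - cintegral mu f.
Proof.
move=> bf; set la := csub nu mu.
have jordan (k : signed_measure X R) A : measurable A ->
    k A = (pos k A - neg k A)%E.
  by move=> mA; rewrite {1}(jordan_decomp (hahn_pos_neg k) mA) /cadd /= cscaleN1.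
have E A : measurable A ->
    (pos la A + (neg nu A + pos mu A) = neg la A + (pos nu A + neg mu A))%E.
  move=> mA; have : la A = (nu A - mu A)%E by [].
  rewrite (jordan la)// (jordan nu)// (jordan mu)//.
  have fp (m : {finite_measure set (borelType X) -> \bar R}) : m A \is a fin_num.
    exact: fin_num_measure.
  rewrite -(fineK (fp (pos la))) -(fineK (fp (neg la))).
  rewrite -(fineK (fp (pos mu))) -(fineK (fp (neg mu))).
  rewrite -(fineK (fp (pos nu))) -(fineK (fp (neg nu))).
  by rewrite -!(EFinD, EFinN) => -[h]; congr (_%:E); lra.
have := Rintegral_add3 E bf; rewrite /cintegral => h; lra.
Qed.
End SignedIntegral.

(** * Total mass, tails, and nonnegative measures *)

Section TotalVariationIntegral.
Context {R : realType} {X : ptopologicalType}.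
Local Notation bm f := (bounded_measurable (f : borelType X -> R)).
Implicit Types (nu mu : signed_measure X R) (f g : X -> R).

Definition tvmass nu : R := fine (Defs.total_variation nu setT).

Lemma total_variation_finE nu (A : set (borelType X)) : measurable A ->
  Defs.total_variation nu A = (fine (Defs.total_variation nu A))%:E.
Proof. by move=> mA; rewrite fineK// total_variation_fin. Qed.

Lemma tvintegral_cst nu (c : R) : tvintegral nu (fun=> c) = c * tvmass nu.
Proof.
rewrite /tvintegral !Rintegral_cst// -mulrDr /tvmass /Defs.total_variation.
by rewrite /charge_variation fineD// fin_num_measure.
Qed.

(** [f] is dominated by the indicator of the complement of [K]. *)
Lemma tvintegral_le_compl nu (K : set (borelType X)) f (e : R) :
  measurable K -> bm f -> (forall x, 0 <= f x <= 1) -> (forall x, K x -> f x = 0) ->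
  (Defs.total_variation nu (~` K) < e%:E)%E -> tvintegral nu f <= e.
Proof.
move=> mK bf f01 fK; have mCK := measurableC mK.
rewrite total_variation_finE// lte_fin -tvintegral_indic// => /ltW; apply: le_trans.
apply: le_tvintegral => //.
  split; first exact: measurable_indic.
  by exists 1 => x; rewrite indicE; case: (_ \in _); rewrite ?normr0 ?normr1.
move=> x; rewrite indicE; case: (pselect (K x)) => Kx.
  by rewrite fK.
by rewrite mem_set//; case/andP: (f01 x).
Qed.

(** The negative Jordan part of [A] is minus the [nu]-measure of a subset of [A], hence at most 0,
    hence 0. *)
Lemma cintegral_nonneg nu f :
  (forall B : set (borelType X), measurable B -> (0 <= nu B)%E) ->
  cintegral nu f = tvintegral nu f.
Proof.
move=> nu0; rewrite /cintegral /tvintegral.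
suff -> : \int[jordan_neg (hahn_pos_neg nu)]_x f x = 0 by rewrite subr0 addr0.
rewrite /Rintegral.
rewrite (eq_measure_integral mzero) ?integral_measure_zero// => A mA _.
have [_ [mN _] _ _] := hahn_pos_neg nu.
suff : (jordan_neg (hahn_pos_neg nu) A <= 0)%E.
  by move=> le0; apply/eqP; rewrite eq_le measure_ge0 andbT.
rewrite jordan_negE cjordan_negE leeNl oppe0 /crestr0/= mem_set// /crestr.
by apply: nu0; exact: measurableI.
Qed.

Lemma continuous_bounded_measurable f :
  continuous f -> (exists C, forall x, `|f x| <= C) -> bm f.
Proof.
move=> /continuousP cf bf; split=> //.
apply: (measurability _ (RGenOpens.measurableE R)).
move=> _ [_ [a [b ->] <-]]; rewrite setTI; apply: sub_sigma_algebra.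
exact/cf/interval_open.
Qed.

End TotalVariationIntegral.

(** * Balls of a directed family of pseudometrics, and compact covers *)

Section Pseudometrics.
Context {R : realType} {X : topologicalType}.
Variable Pi : set (X -> X -> R).
Hypothesis Pi_pseudometric : forall p, Pi p -> is_pseudometric p.
Hypothesis Pi_generates : topology_generated_by Pi.
Hypothesis Pi_directed : directed_family Pi.

Lemma nbhs_pseudoball p x (e : R) : Pi p -> 0 < e -> nbhs x [set y | p x y < e].
Proof.
move=> Pip e0; apply/Pi_generates; exists 1, (fun=> p), e; split=> //.
by move=> y /(_ ord0).
Qed.

Lemma lipschitz_continuous p (L : R) (f : X -> R) : Pi p ->
  (forall x y, `|f x - f y| <= L * p x y) -> continuous f.
Proof.
move=> Pip fL x; apply/cvgrPdist_lt => e e0.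
have L0 : 0 < `|L| + 1 by rewrite ltr_pwDr.
apply: filterS (nbhs_pseudoball x Pip (divr_gt0 e0 L0)) => y /=.
rewrite ltr_pdivlMr// mulrC; apply: le_lt_trans; apply: (le_trans (fL x y)).
have [_ p0 _ _] := Pi_pseudometric Pip.
by rewrite ler_wpM2r// (le_trans (ler_norm _))// lerDl.
Qed.

Lemma directed_seq (I : eqType) (s : seq I) (P : I -> X -> X -> R) (E : I -> R) :
  (forall i, Pi (P i)) -> (forall i, 0 < E i) ->
  exists p (d : R), [/\ Pi p, 0 < d &
    forall x y, p x y < d -> forall i, i \in s -> P i x y < E i].
Proof.
move=> PiP E0; elim: s => [|i s [p [d [Pip d0 ps]]]].
  by have [[p Pip] _] := Pi_directed; exists p, 1; split.
(* Directedness offers one common radius for two pseudometrics, so the smaller of the two radii is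
   requested. *)
pose e := Num.min d (E i); have e0 : 0 < e by rewrite lt_min d0 E0.
have [_ /(_ _ _ Pip (PiP i) _ e0)[r [d' [Pir d'0 rpq]]]] := Pi_directed.
exists r, d'; split=> // x y /rpq; rewrite /e !lt_min.
move=> [/andP[pd _] /andP[_ iE]] j; rewrite inE => /predU1P[->//|].
exact: ps.
Qed.

Lemma nbhs_pseudoballP x (A : set X) : nbhs x A ->
  exists p (e : R), [/\ Pi p, 0 < e & [set y | p x y < e] `<=` A].
Proof.
move=> /Pi_generates[n [P [e [PiP e0 PA]]]].
have [p [d [Pip d0 pP]]] :=
  directed_seq (enum 'I_n) PiP (fun=> e0).
exists p, d; split=> // y /pP pPi; apply: PA => i.
by apply: pPi; rewrite mem_enum.
Qed.

End Pseudometrics.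

Lemma compact_nbhs_cover {X : ptopologicalType} (K : set X) (U : X -> set X) :
  compact K -> (forall x, K x -> nbhs x (U x)) ->
  exists s : seq X, K `<=` [set y | exists2 x, x \in s & U x y].
Proof.
rewrite compact_cover => cK nU.
have [|y Ky|D _ KD] := cK X K (fun x => interior (U x)).
- by move=> x _; exact: open_interior.
- by exists y => //; exact: nU.
exists (finmap.enum_fset D) => y /KD[x /= xD /interior_subset Uxy].
by exists x.
Qed.

(** * The two families of seminorms, local tightness, and a partition of unity *)

Section Seminorms.
Context {R : realType} {X : ptopologicalType}.
Variable Pi : set (X -> X -> R).
Hypothesis Pi_pseudometric : forall p, Pi p -> is_pseudometric p.
Hypothesis Pi_generates : topology_generated_by Pi.
Local Notation bm f := (bounded_measurable (f : borelType X -> R)).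
Implicit Types (nu mu : signed_measure X R) (f g : X -> R).

Lemma cintegral_csub_self nu f : bm f -> cintegral (csub nu nu) f = 0.
Proof. by move=> bf; rewrite cintegral_csub// subrr. Qed.

Lemma cintegral_csub_triangle nu nu0 mu f : bm f ->
  cintegral (csub nu mu) f =
  cintegral (csub nu nu0) f + cintegral (csub nu0 mu) f.
Proof. by move=> bf; rewrite !cintegral_csub// addrA subrK. Qed.

Definition KR_ball p : set (X -> R) := [set f | lip1 p f /\ forall x, `|f x| <= 1].

Lemma KR_ball_bounded_measurable p f : Pi p -> KR_ball p f -> bm f.
Proof.
move=> Pip [fp f1]; apply: continuous_bounded_measurable; last by exists 1.
by apply: (lipschitz_continuous Pi_pseudometric Pi_generates Pip (L := 1)) => x y;
  rewrite mul1r.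
Qed.

Lemma KR_ball_opp p f : KR_ball p f -> KR_ball p (fun x => -1 * f x).
Proof.
by move=> [fp f1]; split=> [x y|x] /=; rewrite !mulN1r -?opprD normrN.
Qed.

Lemma KR_ball0 p : Pi p -> KR_ball p (fun=> 0).
Proof.
move=> /Pi_pseudometric[_ p0 _ _]; split=> [x y|x]; first by rewrite subrr normr0.
by rewrite normr0.
Qed.

Lemma cintegral_le_KR p nu f : Pi p -> KR_ball p f ->
  cintegral nu f <= KR_seminorm p nu.
Proof.
move=> Pip pf; apply: ub_le_sup; last by exists f.
(* The total variation bounds all the integrals, so [sup] is a genuine supremum rather than its
   default value. *)
exists (tvintegral nu (fun=> 1)) => _ [g pg <-].
apply: le_trans (ler_norm _) _; apply: normr_cintegral.
- exact: KR_ball_bounded_measurable pg.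
- exact: bounded_measurable_cst.
- by case: pg.
Qed.

Lemma KR_le p nu (c : R) : Pi p ->
  (forall f, KR_ball p f -> cintegral nu f <= c) -> KR_seminorm p nu <= c.
Proof.
move=> Pip fc; apply: ge_sup => [|_ [f pf <-]]; last exact: fc.
by exists (cintegral nu (fun=> 0)), (fun=> 0) => //; exact: KR_ball0.
Qed.

Lemma KR_csub_self p nu : Pi p -> KR_seminorm p (csub nu nu) = 0.
Proof.
move=> Pip; apply/eqP; rewrite eq_le; apply/andP; split.
  apply: KR_le => // f pf; rewrite cintegral_csub_self//.
  exact: KR_ball_bounded_measurable pf.
have p0 := KR_ball0 Pip.
rewrite -(cintegral_csub_self nu (KR_ball_bounded_measurable Pip p0)).
exact: cintegral_le_KR.
Qed.

Lemma KR_triangle p nu nu0 mu : Pi p ->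
  KR_seminorm p (csub nu mu) <=
  KR_seminorm p (csub nu nu0) + KR_seminorm p (csub nu0 mu).
Proof.
move=> Pip; apply: KR_le => // f pf.
rewrite (cintegral_csub_triangle _ nu0); last exact: KR_ball_bounded_measurable pf.
by apply: lerD; exact: cintegral_le_KR.
Qed.

(** Both [f / A] and its opposite lie in the unit ball defining the seminorm; the opposite supplies
    the absolute value. *)
Lemma normr_cintegral_le_KR p nu (A : R) f : Pi p -> 0 < A ->
  (forall x y, `|f x - f y| <= A * p x y) -> (forall x, `|f x| <= A) ->
  `|cintegral nu f| <= A * KR_seminorm p nu.
Proof.
move=> Pip A0 fL fA.
have An0 : A != 0 by rewrite gt_eqF.
pose g x := A^-1 * f x.
have pg : KR_ball p g.
  split=> [x y|x]; rewrite /g -?mulrBr normrM gtr0_norm ?invr_gt0//.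
    by rewrite ler_pdivrMl.
  by rewrite ler_pdivrMl// mulr1.
have bg := KR_ball_bounded_measurable Pip pg.
have -> : f = (fun x => A * g x) by apply/funext => x; rewrite mulVKf.
rewrite cintegralZ// normrM gtr0_norm// ler_pM2l// ler_norml.
rewrite cintegral_le_KR// andbT lerNl -mulN1r -cintegralZ//.
exact/cintegral_le_KR/KR_ball_opp.
Qed.

Lemma near_weak nu0 f (e : R) :
  continuous f -> (exists C, forall x, `|f x| <= C) -> 0 < e ->
  \forall nu \near (nu0 : seminorm_space (@weak_seminorms X R)),
    `|cintegral (csub nu nu0) f| < e.
Proof.
move=> cf fC e0.
apply: (@near_semiball _ _ _ (fun nu => `|cintegral nu f|)) => //.
  by exists f => //; split => //; exact/bounded_funP.
by rewrite cintegral_csub_self ?normr0//; exact: continuous_bounded_measurable.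
Qed.

Lemma near_weak_sum (I : Type) (s : seq I) (F : I -> X -> R) nu0 (e : R) :
  (forall i, continuous (F i)) -> (forall i, exists C, forall x, `|F i x| <= C) ->
  0 < e ->
  \forall nu \near (nu0 : seminorm_space (@weak_seminorms X R)),
    \sum_(i <- s) `|cintegral (csub nu nu0) (F i)| < e.
Proof.
move=> cF bF; elim: s e => [|i s IH] e e0.
  apply: (@filterE _ (nbhs (nu0 : seminorm_space (@weak_seminorms X R)))) => nu.
  by rewrite big_nil.
have e20 : 0 < e / 2 by rewrite divr_gt0.
apply: filterS2 (near_weak nu0 (cF i) (bF i) e20) (IH _ e20) => nu.
by rewrite big_cons [in X in _ -> _ -> _ < X](splitr e); exact: ltrD.
Qed.

(** A single semiball, of radius [e / A], serves all such [f] at once. *)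
Lemma near_KR p nu0 (A e : R) : Pi p -> 0 < A -> 0 < e ->
  \forall nu \near (nu0 : seminorm_space (KR_seminorms Pi)),
    forall f, (forall x y, `|f x - f y| <= A * p x y) ->
    (forall x, `|f x| <= A) -> `|cintegral (csub nu nu0) f| < e.
Proof.
move=> Pip A0 e0.
have : \forall nu \near (nu0 : seminorm_space (KR_seminorms Pi)),
    KR_seminorm p (csub nu nu0) < e / A.
  apply: (@near_semiball _ _ _ (KR_seminorm p)); rewrite ?divr_gt0//.
    by exists p.
  exact: KR_csub_self.
apply: filterS => nu /= + f fL fA; rewrite ltr_pdivlMr// mulrC.
exact/le_lt_trans/normr_cintegral_le_KR.
Qed.

(** [K] is chosen before [u], because each direction builds its own [u] from [K]. Closeness is asked
    only for the integrals of 1 and [u], which either topology can enforce. *)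
Definition locally_tight (M : set (signed_measure X R)) := forall nu0, M nu0 ->
  exists C : R, forall eta : R, 0 < eta -> exists K : set X, compact K /\
  forall u : X -> R, continuous u -> (forall x, 0 <= u x <= 1) ->
  (forall x, K x -> u x = 0) -> forall nu, M nu ->
  `|cintegral (csub nu nu0) (fun=> 1)| < 1 ->
  `|cintegral (csub nu nu0) u| < eta ->
  tvmass nu <= C /\ tvintegral nu u <= 2 * eta.

Lemma continuous01_bounded_measurable (u : X -> R) :
  continuous u -> (forall x, 0 <= u x <= 1) -> bm u.
Proof.
move=> cu u01; apply: continuous_bounded_measurable => //.
by exists 1 => x; case/andP: (u01 x) => ? ?; rewrite ger0_norm.
Qed.

(** Masses are integrals of 1, hence the constant [tvmass nu0 + 1]. The compact set comes from [nu0]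
    alone: its tail contributes one [eta] to the integral of [u], the closeness of [nu] to [nu0] the
    other. *)
Lemma nonneg_radon_locally_tight : locally_tight (@nonneg_radon X R).
Proof.
move=> nu0 [rnu0 nu0_ge0]; exists (tvmass nu0 + 1) => eta eta0.
have [K [cK mK _ KT]] := rnu0 setT measurableT eta eta0.
rewrite setTD in KT.
exists K; split=> // u cu u01 uK nu [rnu nu_ge0].
have bu := continuous01_bounded_measurable cu u01.
rewrite !cintegral_csub//; last exact: bounded_measurable_cst.
rewrite !cintegral_nonneg// !tvintegral_cst !mul1r.
move=> /(le_lt_trans (ler_norm _)) h1 /(le_lt_trans (ler_norm _)) h2.
have := tvintegral_le_compl mK bu u01 uK KT.
by split; lra.
Qed.

(** The variation bound and the tightness compact hold on all of [M], not merely near [nu0]. *)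
Lemma uniformly_tight_locally_tight (M : set (signed_measure X R)) :
  bounded_in_variation M -> uniformly_tight M -> locally_tight M.
Proof.
move=> [C MC] tM nu0 _; exists C => eta eta0.
have [K [cK mK KM]] := tM eta eta0.
exists K; split=> // u cu u01 uK nu Mnu _ _; split.
  by rewrite -lee_fin -total_variation_finE//; exact: MC.
have bu := continuous01_bounded_measurable cu u01.
have := tvintegral_le_compl mK bu u01 uK (KM _ Mnu); lra.
Qed.

(** Tents of height and radius [e] around the centres of finitely many [e / 2]-balls covering [K]
    are divided by a positive continuous function that equals their sum on [K]. *)
Lemma partition_of_unity p (K : set X) (e : R) : Pi p -> 0 < e -> compact K ->
  exists (s : seq X) (psi : X -> X -> R) (u : X -> R),
  [/\ forall i, continuous (psi i) /\ (exists C, forall x, `|psi i x| <= C),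
      forall i x, 0 <= psi i x /\ (e <= p i x -> psi i x = 0),
      continuous u /\ (forall x, 0 <= u x <= 1),
      forall x, K x -> u x = 0 &
      forall x, \sum_(i <- s) psi i x + u x = 1].
Proof.
move=> Pip e0 cK; have e20 : 0 < e / 2 by rewrite divr_gt0.
have [s Ks] := compact_nbhs_cover cK
  (fun x _ => nbhs_pseudoball Pi_generates x Pip e20).
have [p0 pge0 psym ptri] := Pi_pseudometric Pip.
pose phi i x := Num.max 0 (e - p i x).
have phi_ge0 i x : 0 <= phi i x by rewrite le_max lexx.
have phi_le i x : phi i x <= e.
  by rewrite ge_max (ltW e0) lerBlDr lerDl pge0.
have cphi i : continuous (phi i).
  apply: (lipschitz_continuous Pi_pseudometric Pi_generates Pip (L := 1)) => x y.
  rewrite mul1r /phi; have := ptri i x y; have := ptri i y x; rewrite (psym y x) => h1 h2.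
  rewrite ler_norml.
  by case: (leP 0 (e - p i x)) => ?; case: (leP 0 (e - p i y)) => ?;
    apply/andP; split; lra.
pose S x := \sum_(i <- s) phi i x.
have cS : continuous S.
  rewrite /S; elim: (s) => [|i t IH] x.
    by under eq_fun do rewrite big_nil; exact: cvg_cst.
  by under eq_fun do rewrite big_cons; apply: cvgD; [exact: cphi|exact: IH].
have S_ge0 x : 0 <= S x by apply: sumr_ge0.
(* The sum [S] may vanish off [K], so it is truncated below. On [K] some centre is within [e / 2],
   so its tent is at least [e / 2] there and the truncation has no effect. *)
pose D x := Num.max (S x) (e / 2).
have D_gt0 x : 0 < D x by rewrite lt_max e20 orbT.
have D_ge x : e / 2 <= D x by rewrite le_max lexx orbT.
have cDV : continuous (fun x => (D x)^-1).
  move=> x; apply: continuousV; first by rewrite gt_eqF.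
  by apply: continuous_max; [exact: cS|exact: cvg_cst].
have KS x : K x -> D x = S x.
  move=> /Ks[i si /= pix]; apply/max_idPl.
  have phiS : phi i x <= S x.
    by rewrite /S (big_rem i)//= lerDl; apply: sumr_ge0.
  by apply: le_trans phiS; rewrite le_max; apply/orP; right; lra.
exists s, (fun i x => phi i x * (D x)^-1), (fun x => 1 - S x * (D x)^-1).
split.
- move=> i; split; first by move=> x; apply: cvgM; [exact: cphi|exact: cDV].
  exists 2 => x; rewrite ger0_norm ?divr_ge0 ?(ltW (D_gt0 x))//.
  by rewrite ler_pdivrMr//; have := D_ge x; have := phi_le i x; lra.
- move=> i x; split; first by rewrite divr_ge0 ?(ltW (D_gt0 x)).
  move=> eix; rewrite /phi; suff -> : Num.max 0 (e - p i x) = 0 by rewrite mul0r.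
  by apply/max_idPl; rewrite subr_le0.
- split.
    move=> x; apply: cvgB; first exact: cvg_cst.
    by apply: cvgM; [exact: cS|exact: cDV].
  move=> x; rewrite subr_ge0 ler_pdivrMr// mul1r lerBlDr lerDl.
  by rewrite divr_ge0 ?(ltW (D_gt0 x))// andbT le_max lexx.
- by move=> x /KS DS; rewrite -DS divff ?subrr// gt_eqF.
- by move=> x; rewrite -mulr_suml addrC subrK.
Qed.

End Seminorms.

(** * Inf-convolution with a multiple of a pseudometric *)

Section InfConvolution.
Context {R : realType} {X : ptopologicalType}.
Variables (p : X -> X -> R) (L c : R) (F : X -> R).
Hypothesis pp : is_pseudometric p.
Hypothesis L0 : 0 <= L.
Hypothesis cF : forall x, c <= F x.

(** For a pseudometric [p], [L >= 0] and [F] bounded below, this is the largest minorant of [F] that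
    is [L]-Lipschitz for [p]. *)
Definition infconv x := inf (range (fun y => F y + L * p x y)).

Lemma le_infconv x (a : R) : (forall y, a <= F y + L * p x y) -> a <= infconv x.
Proof.
move=> aF; apply: lb_le_inf => [|_ [y _ <-]]; last exact: aF.
by exists (F x + L * p x x), x.
Qed.

Lemma infconv_le x y : infconv x <= F y + L * p x y.
Proof.
apply: ge_inf; last by exists y.
exists c => _ [z _ <-]; rewrite (le_trans (cF z))// lerDl mulr_ge0//.
by have [_ p0 _ _] := pp.
Qed.

Lemma infconv_le_self x : infconv x <= F x.
Proof.
have [p0 _ _ _] := pp.
by rewrite (le_trans (infconv_le x x))// p0 mulr0 addr0.
Qed.

Lemma infconv_ge x : c <= infconv x.
Proof.
have [_ p0 _ _] := pp.
by apply: le_infconv => y; rewrite (le_trans (cF y))// lerDl mulr_ge0.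
Qed.

Lemma infconv_lipschitz x y : `|infconv x - infconv y| <= L * p x y.
Proof.
have [_ _ psym ptri] := pp.
have lip a b : infconv a - L * p a b <= infconv b.
  apply: le_infconv => z; rewrite lerBlDr (le_trans (infconv_le a z))//.
  by rewrite -addrA lerD2l -mulrDr ler_wpM2l// addrC; exact: ptri.
have := lip x y; have := lip y x; rewrite (psym y x) => h1 h2.
by rewrite ler_norml; apply/andP; split; lra.
Qed.

End InfConvolution.

(** * Comparison of the two topologies *)

Section Main.
Context {R : realType} {X : ptopologicalType}.
Variable Pi : set (X -> X -> R).
Hypothesis Pi_pseudometric : forall p, Pi p -> is_pseudometric p.
Hypothesis Pi_generates : topology_generated_by Pi.
Hypothesis Pi_directed : directed_family Pi.
Local Notation bm f := (bounded_measurable (f : borelType X -> R)).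
Implicit Types (nu mu : signed_measure X R) (f g : X -> R).

Lemma lipschitz_approximation f (B : R) (K : set X) (e : R) :
  continuous f -> (forall x, `|f x| <= B) -> compact K -> 0 < B -> 0 < e ->
  exists (p : X -> X -> R) (A : R) (g u : X -> R),
  [/\ Pi p /\ 1 <= A,
      (forall x y, `|g x - g y| <= A * p x y) /\ (forall x, `|g x| <= A),
      (forall x y, `|u x - u y| <= A * p x y) /\ (forall x, 0 <= u x <= 1),
      forall x, K x -> u x = 0 &
      forall x, `|f x - g x| <= e + 2 * B * u x].
Proof.
move=> cf fB cK B0 e0.
have e40 : 0 < e / 4 by rewrite divr_gt0.
have /choice[PE PEP] : forall x, exists pe : (X -> X -> R) * R,
    [/\ Pi pe.1, 0 < pe.2 & [set y | pe.1 x y < pe.2] `<=`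
      [set y | `|f x - f y| < e / 4]].
  move=> x; have /cvgrPdist_lt/(_ _ e40) := cf x.
  by move=> /(nbhs_pseudoballP Pi_generates Pi_directed)[p [d pd]]; exists (p, d).
have PiP x : Pi (PE x).1 by have [] := PEP x.
(* Covering [K] by balls of half radius keeps points close to [K] inside the full balls, where [f]
   varies little. *)
have E0 x : 0 < (PE x).2 / 2 by have [_ ? _] := PEP x; rewrite divr_gt0.
have [s Ks] := compact_nbhs_cover cK
  (fun x _ => nbhs_pseudoball Pi_generates x (PiP x) (E0 x)).
have [p [d [Pip d0 pP]]] := directed_seq Pi_directed s PiP E0.
have pp := Pi_pseudometric Pip; have [p0 pge0 psym ptri] := pp.
have near_K z y : K z -> p z y < d -> `|f z - f y| < e / 2.
  move=> /Ks[i si /= iz] /pP /(_ _ si) zy.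
  have [_ _ fi] := PEP i; have [_ _ _ tri] := Pi_pseudometric (PiP i).
  have half_lt : (PE i).2 / 2 < (PE i).2 by have := E0 i; lra.
  have fz : `|f i - f z| < e / 4 by apply: fi; exact: lt_trans iz half_lt.
  have fy : `|f i - f y| < e / 4.
    by apply: fi => /=; have := tri i z y; lra.
  rewrite distrC in fz.
  have := ler_distD (f i) (f z) (f y); lra.
(* Moving a distance [d / 2] then costs [2 * B], the maximal oscillation of [f], in [g], and 1 in
   [u]. *)
pose L := 4 * B / d; pose l := 2 / d.
have L0 : 0 <= L by rewrite ltW// divr_gt0// mulr_gt0.
have l0 : 0 <= l by rewrite ltW// divr_gt0.
have fge x : - B <= f x by have := fB x; rewrite ler_norml => /andP[].
have fle x : f x <= B by have := fB x; rewrite ler_norml => /andP[].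
pose F x : R := \1_(~` K) x.
have F0 x : 0 <= F x by [].
have F1 x : F x <= 1 by rewrite /F indicE; case: (_ \in _).
pose g := infconv p L f; pose u := infconv p l F.
(* One constant dominates both slopes and all sup norms, including that of the constant 1 needed
   later. *)
pose A := L + l + B + 1.
have LA : L <= A by rewrite /A; lra.
have lA : l <= A by rewrite /A; lra.
have BA : B <= A by rewrite /A; lra.
have A1 : 1 <= A by rewrite /A; lra.
have g_lef x : g x <= f x := infconv_le_self pp L0 fge x.
have g_geB x : - B <= g x := infconv_ge pp L0 fge x.
have u_ge0 x : 0 <= u x := infconv_ge pp l0 F0 x.
have u_leF x : u x <= F x := infconv_le_self pp l0 F0 x.
exists p, A, g, u; split=> //.
- split=> [x y|x].
    by rewrite (le_trans (infconv_lipschitz pp L0 fge x y))// ler_wpM2r.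
  by rewrite ler_norml; apply/andP; split; have := g_lef x; have := g_geB x;
    have := fle x; lra.
- split=> [x y|x].
    by rewrite (le_trans (infconv_lipschitz pp l0 F0 x y))// ler_wpM2r.
  by rewrite u_ge0 (le_trans (u_leF x)).
- move=> x Kx; apply/eqP; rewrite eq_le u_ge0 andbT (le_trans (u_leF x))//.
  by rewrite /F indicE memNset//=; exact.
- move=> x; rewrite ger0_norm ?subr_ge0//.
  have d20 : 0 < d / 2 by rewrite divr_gt0.
  (* Within [d / 2] of [K], uniform continuity handles nearby [y] and the penalty handles distant
     ones, so the error is at most [e]. Elsewhere [u] is at least 1 and [2 * B * u] absorbs the
     whole gap. *)
  have [[z Kz xz]|far] := pselect (exists2 z, K z & p x z < d / 2).
    suff : f x - e <= g x.
      have : 0 <= 2 * B * u x by rewrite !mulr_ge0// ltW.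
      by lra.
    apply: le_infconv => y.
    have [xy|xy] := ltP (p x y) (d / 2).
      have zx : `|f z - f x| < e / 2 by apply: near_K => //; rewrite psym; lra.
      have zy : `|f z - f y| < e / 2.
        by apply: near_K => //; have := ptri z x y; rewrite (psym z x); lra.
      have : 0 <= L * p x y by rewrite mulr_ge0.
      move: zx zy; rewrite !ltr_norml => /andP[? ?] /andP[? ?]; lra.
    have : L * (d / 2) <= L * p x y by rewrite ler_wpM2l.
    have -> : L * (d / 2) = 2 * B by rewrite /L; field; rewrite gt_eqF.
    by have := fge y; have := fle x; lra.
  suff : 1 <= u x.
    move=> u1; have : 2 * B * 1 <= 2 * B * u x by rewrite ler_wpM2l// mulr_ge0// ltW.
    by have := g_geB x; have := fle x; lra.
  apply: le_infconv => y; have [Ky|nKy] := pselect (K y).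
    have xy : d / 2 <= p x y by rewrite leNgt; apply/negP => xy; apply: far; exists y.
    have : l * (d / 2) <= l * p x y by rewrite ler_wpM2l.
    have -> : l * (d / 2) = 1 by rewrite /l; field; rewrite gt_eqF.
    by have := F0 y; lra.
  by rewrite /F indicE mem_set// lerDl mulr_ge0.
Qed.

(** Integrates the pointwise bound against the variation of [nu]; both directions use it for their
    approximation error [r]. *)
Lemma normr_cintegral_le_affine nu (r u : X -> R) (a b C t : R) :
  bm r -> bm u -> 0 <= a -> 0 <= b ->
  (forall x, `|r x| <= a + b * u x) -> tvmass nu <= C -> tvintegral nu u <= t ->
  `|cintegral nu r| <= a * C + b * t.
Proof.
move=> br bu a0 b0 rau nuC nut.
have bbu := bounded_measurableZ b bu.
have ba := @bounded_measurable_cst _ (borelType X) R a.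
apply: (le_trans (normr_cintegral nu br (bounded_measurableD ba bbu) rau)).
rewrite (tvintegralD nu ba bbu) tvintegral_cst tvintegralZ//.
by rewrite lerD// ler_wpM2l.
Qed.

Lemma weak_near_KR M p nu0 (e : R) : locally_tight M -> Pi p -> M nu0 -> 0 < e ->
  \forall nu \near (nu0 : seminorm_space (@weak_seminorms X R)),
    M nu -> KR_seminorm p (csub nu nu0) < e.
Proof.
move=> tM Pip Mnu0 e0; have [C CM] := tM nu0 Mnu0.
have [K [cK KM]] := CM (e / 32) ltac:(lra).
have C0 : 0 < `|C| + 1 by rewrite ltr_pwDr.
(* With [eps * C <= e / 16] and tail [2 * (e / 32)], the remainder costs [e / 8] for each of [nu]
   and [nu0]. *)
pose eps := e / (16 * (`|C| + 1)).
have eps0 : 0 < eps by rewrite divr_gt0// mulr_gt0.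
have epsC : eps * C <= e / 16.
  have -> : e / 16 = eps * (`|C| + 1) by rewrite /eps; field; rewrite gt_eqF.
  by rewrite ler_wpM2l ?(ltW eps0)// (le_trans (ler_norm _))// lerDl.
have [s [psi [u [psiP psi0 [cu u01] uK psi1]]]] :=
  partition_of_unity Pi_pseudometric Pi_generates Pip eps0 cK.
have [c1 b1] : continuous (fun _ : X => 1 : R) /\
    (exists C, forall x : X, `|(1 : R)| <= C).
  by split; [move=> x; exact: cvg_cst|exists 1; rewrite normr1].
have bu := continuous01_bounded_measurable cu u01.
have ub : exists C, forall x, `|u x| <= C by case: bu.
have e32 : 0 < e / 32 by rewrite divr_gt0.
have e4 : 0 < e / 4 by rewrite divr_gt0.
apply: filterS3 (near_weak nu0 c1 b1 ltr01) (near_weak nu0 cu ub e32)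
  (near_weak_sum s nu0 (fun i => (psiP i).1) (fun i => (psiP i).2) e4).
move=> nu nu1 nuu nusum Mnu.
have [nuC nuT] := KM u cu u01 uK nu Mnu nu1 nuu.
(* Local tightness applies to [nu0] itself, whose difference with itself integrates to 0. *)
have [nu0C nu0T] : tvmass nu0 <= C /\ tvintegral nu0 u <= 2 * (e / 32).
  by apply: KM => //; rewrite cintegral_csub_self ?normr0//.
(* A bound on every member passes to the supremum only as a weak inequality, hence the target
   [e / 2 = e / 4 + e / 8 + e / 8]. *)
apply: (@le_lt_trans _ _ (e / 2)); last by lra.
apply: (KR_le Pi_pseudometric Pip) => f pf.
have bf := KR_ball_bounded_measurable Pi_pseudometric Pi_generates Pip pf.
have bpsi i : bm (psi i).
  by have [? ?] := psiP i; exact: continuous_bounded_measurable.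
have bfpsi i := bounded_measurableZ (f i) (bpsi i).
pose g x := \sum_(i <- s) f i * psi i x; pose r x := f x - g x.
have [bg gE] : bm g /\ forall la : signed_measure X R,
    cintegral la g = \sum_(i <- s) f i * cintegral la (psi i).
  split; first by have [] := cintegral_sum s nu bfpsi.
  move=> la; have [_ ->] := cintegral_sum s la bfpsi.
  by apply: eq_bigr => i _; rewrite cintegralZ.
have br : bm r by exact: bounded_measurableB.
have [fL f1] := pf.
(* The coefficients [f i] are at most 1 in absolute value, so the bound is the same for every [f] in
   the ball. *)
have gle : `|cintegral (csub nu nu0) g| <= e / 4.
  rewrite gE; apply: le_trans (ltW nusum); apply: (le_trans (ler_norm_sum _ _ _)).
  by apply: ler_sum => i _; rewrite normrM ler_piMl.
have rle x : `|r x| <= eps + 1 * u x.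
  have -> : r x = \sum_(i <- s) (f x - f i) * psi i x + f x * u x.
    rewrite /r -[in LHS](mulr1 (f x)) -(psi1 x) mulrDr addrAC; congr (_ + _).
    by rewrite mulr_sumr -sumrB; apply: eq_bigr => i _; rewrite mulrBl.
  have /andP[u0 _] := u01 x.
  apply: (le_trans (ler_normD _ _)); apply: lerD; last first.
    by rewrite normrM (ger0_norm u0) ler_wpM2r.
  apply: (le_trans (ler_norm_sum _ _ _)).
  apply: (@le_trans _ _ (\sum_(i <- s) eps * psi i x)).
    apply: ler_sum => i _; have [psi_ge0 psi_eq0] := psi0 i x.
    rewrite normrM (ger0_norm psi_ge0).
    have [pe|/psi_eq0 ->] := ltP (p i x) eps; last by rewrite !mulr0.
    by rewrite ler_wpM2r// distrC (le_trans (fL i x))// ltW.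
  rewrite -mulr_sumr -[leRHS]mulr1 ler_wpM2l ?(ltW eps0)//.
  by rewrite -(psi1 x) lerDl.
have rint la : tvmass la <= C -> tvintegral la u <= 2 * (e / 32) ->
    `|cintegral la r| <= e / 8.
  move=> laC lau; have := normr_cintegral_le_affine br bu (ltW eps0) ler01 rle laC lau.
  by lra.
have -> : f = (fun x => g x + r x) by apply/funext => x; rewrite /r addrC subrK.
rewrite cintegralD// (cintegral_csub nu nu0 br).
have := rint nu nuC nuT; have := rint nu0 nu0C nu0T; move: gle.
rewrite !ler_norml => /andP[? ?] /andP[? ?] /andP[? ?]; lra.
Qed.

Lemma KR_near_weak M f nu0 (e : R) : locally_tight M -> continuous f ->
  (exists B, forall x, `|f x| <= B) -> M nu0 -> 0 < e ->
  \forall nu \near (nu0 : seminorm_space (KR_seminorms Pi)),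
    M nu -> `|cintegral (csub nu nu0) f| < e.
Proof.
move=> tM cf [B' fB'] Mnu0 e0; have [C CM] := tM nu0 Mnu0.
pose B := `|B'| + 1.
have B0 : 0 < B by rewrite ltr_pwDr.
have fB x : `|f x| <= B.
  by rewrite (le_trans (fB' x))// (le_trans (ler_norm _))// lerDl.
(* The tail enters with factor [2 * B]. The errors are [e / 16 + e / 8] for each measure and [e / 2]
   for [g], which total less than [e]. *)
pose eta := e / (32 * B).
have eta0 : 0 < eta by rewrite divr_gt0// mulr_gt0.
have etaB : 2 * B * (2 * eta) = e / 8 by rewrite /eta; field; rewrite gt_eqF.
have [K [cK KM]] := CM eta eta0.
have C0 : 0 < `|C| + 1 by rewrite ltr_pwDr.
pose eps := e / (16 * (`|C| + 1)).
have eps0 : 0 < eps by rewrite divr_gt0// mulr_gt0.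
have epsC : eps * C <= e / 16.
  have -> : e / 16 = eps * (`|C| + 1) by rewrite /eps; field; rewrite gt_eqF.
  by rewrite ler_wpM2l ?(ltW eps0)// (le_trans (ler_norm _))// lerDl.
have [p [A [g [u [[Pip A1] [gL gA] [uL u01] uK fgu]]]]] :=
  lipschitz_approximation cf fB cK B0 eps0.
have A0 : 0 < A by lra.
have [_ pge0 _ _] := Pi_pseudometric Pip.
have cu := lipschitz_continuous Pi_pseudometric Pi_generates Pip uL.
have cg := lipschitz_continuous Pi_pseudometric Pi_generates Pip gL.
have bu := continuous01_bounded_measurable cu u01.
have bg : bm g by apply: continuous_bounded_measurable => //; exists A.
have bf : bm f by apply: continuous_bounded_measurable => //; exists B.
(* The three thresholds are those for [u], for the constant 1 and for [g], all met by one
   semiball. *)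
pose d := Num.min (Num.min eta 1) (e / 2).
have d0 : 0 < d by rewrite !lt_min eta0 ltr01 divr_gt0.
apply: filterS (near_KR Pi_pseudometric Pi_generates nu0 Pip A0 d0).
move=> nu nuKR Mnu.
have uA x : `|u x| <= A by have /andP[? ?] := u01 x; rewrite ger0_norm//; lra.
have := nuKR u uL uA; rewrite !lt_min => /andP[/andP[nuu _] _].
have := nuKR g gL gA; rewrite !lt_min => /andP[_ nug].
(* The constant 1 is admissible because [1 <= A]. *)
have := nuKR (fun=> 1); rewrite !lt_min => /(_ _ _)/andP[||/andP[_ nu1] _].
- by move=> x y; rewrite subrr normr0 mulr_ge0// ltW.
- by move=> x; rewrite normr1.
have [nuC nuT] := KM u cu u01 uK nu Mnu nu1 nuu.
have [nu0C nu0T] : tvmass nu0 <= C /\ tvintegral nu0 u <= 2 * eta.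
  apply: KM => //; rewrite cintegral_csub_self ?normr0//.
  exact: bounded_measurable_cst.
pose r x := f x - g x; have br : bm r by exact: bounded_measurableB.
have rint la : tvmass la <= C -> tvintegral la u <= 2 * eta ->
    `|cintegral la r| <= e / 16 + e / 8.
  move=> laC lau; rewrite -etaB.
  have BB : 0 <= 2 * B by rewrite mulr_ge0// ltW.
  have := normr_cintegral_le_affine br bu (ltW eps0) BB fgu laC lau.
  by move=> /le_trans; apply; rewrite lerD2r.
have -> : f = (fun x => g x + r x) by apply/funext => x; rewrite /r addrC subrK.
rewrite cintegralD// (cintegral_csub nu nu0 br).
have := rint nu nuC nuT; have := rint nu0 nu0C nu0T; move: nug.
rewrite !ler_norml !ltr_norml => /andP[? ?] /andP[? ?] /andP[? ?].
by apply/andP; split; lra.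
Qed.

Lemma locally_tight_same_topology M : locally_tight M ->
  same_topology_on (@weak_seminorms X R) (KR_seminorms Pi) M.
Proof.
move=> tM U; split; apply: open_subspace_transfer.
- move=> _ nu nu0 mu [f [cf /bounded_funP bf] <-].
  rewrite (cintegral_csub_triangle nu nu0); first exact: ler_normD.
  exact: continuous_bounded_measurable.
- by move=> _ nu0 e [f [cf /bounded_funP bf] <-] Mnu0 e0; exact: KR_near_weak.
- by move=> _ nu nu0 mu [p Pip <-]; exact: (KR_triangle Pi_pseudometric Pi_generates).
- by move=> _ nu0 e [p Pip <-] Mnu0 e0; exact: weak_near_KR.
Qed.

End Main.

Theorem theorem2p1 (R : realType) (X : ptopologicalType)
    (Xreg : completely_regular_space X) (Pi : set (X -> X -> R))
    (Pi_pseudometric : forall p, Pi p -> is_pseudometric p)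
    (Pi_generates : topology_generated_by Pi)
    (Pi_directed : directed_family Pi) :
  same_topology_on weak_seminorms (KR_seminorms Pi) nonneg_radon /\
  (forall M : set (signed_measure X R),
     M `<=` radon -> bounded_in_variation M -> uniformly_tight M ->
     same_topology_on weak_seminorms (KR_seminorms Pi) M).
Proof.
split=> [|M _ bM tM]; apply: locally_tight_same_topology => //.
  exact: nonneg_radon_locally_tight.
exact: uniformly_tight_locally_tight.
Qed.
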